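(* Let $Z=(z_0^{n_0}+z_1^{n_1}+z_2^{n_2}+z_3^{n_3}+z_4^{n_4}+z_5^{n_5}=0)$ be a quasi-$K3$ Fermat fourfold in a weighted projective space, with all $n_j>1$. Then the identity $$2=\frac1{n_0}+\frac1{n_1}+\frac1{n_2}+\frac1{n_3}+\frac1{n_4}+\frac1{n_5}$$ holds and (up to reordering) its right-hand side is one of the following: (a) a sum $\frac12+\frac12+\frac1a+\frac1b+\frac1c+\frac1d$ where $\frac1a+\frac1b+\frac1c+\frac1d=1$ is one of the 14 partitions $\frac12+\frac13+\frac17+\frac1{42}$, $\frac12+\frac13+\frac18+\frac1{24}$, $\frac12+\frac13+\frac19+\frac1{18}$, $\frac12+\frac13+\frac1{10}+\frac1{15}$, $\frac12+\frac13+\frac1{12}+\frac1{12}$, $\frac12+\frac14+\frac15+\frac1{20}$, $\frac12+\frac14+\frac16+\frac1{12}$, $\frac12+\frac14+\frac18+\frac18$, $\frac12+\frac15+\frac15+\frac1{10}$, $\frac12+\frac16+\frac16+\frac16$, $\frac13+\frac13+\frac14+\frac1{12}$, $\frac13+\frac13+\frac16+\frac16$, $\frac13+\frac14+\frac14+\frac16$, $\frac14+\frac14+\frac14+\frac14$; (b) a sum $\alpha+\beta$ where each of $\alpha$ and $\beta$ is one of the partitions of $1$: $\frac13+\frac13+\frac13$, $\frac12+\frac13+\frac16$, $\frac12+\frac14+\frac14$.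
   Context: Let $\mathbb{W}$ be a well-formed weighted projective space over $\mathbb{C}$ and $s(\mathbb{W})$ the sum of its weights. A quasi-smooth hypersurface $Z=(f=0)\subset\mathbb{W}$ of even dimension is called a quasi-$K3$ if $\frac12(\dim_{\mathbb{C}}Z)\deg(f)=s(\mathbb{W})$. Here $Z$ is a fourfold in $\mathbb{P}(w_0,\dots,w_5)$ and the Fermat polynomial is weighted homogeneous, so $n_jw_j=\deg f$ for all $j$. *)

(* Defs.v *)
From HB Require Import structures.
From mathcomp Require Import all_boot all_order all_algebra.
From mathcomp Require Import reals.
From mathcomp Require Import complex.
From mathcomp Require Import mpoly.

Set Implicit Arguments.
Unset Strict Implicit.
Unset Printing Implicit Defensive.

Import GRing.Theory.
Local Open Scope ring_scope.

(* A weighted projective space P(w_0, ..., w_(k-1)) is given by its weights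
   w : 'I_k -> nat, and a hypersurface (f = 0) in it by its equation
   f : {mpoly C[k]}. The field C of complex numbers is R[i] with R : realType. *)

(* The weights are positive and every k - 1 of them have gcd 1. *)
Definition well_formed (k : nat) (w : 'I_k -> nat) : Prop :=
  (forall i, (0 < w i)%N) /\
  (forall i, \big[gcdn/0%N]_(j < k | j != i) w j = 1%N).

Definition sum_weights (k : nat) (w : 'I_k -> nat) : nat := (\sum_(j < k) w j)%N.

Definition mnm_wdeg (k : nat) (w : 'I_k -> nat) (m : 'X_{1..k}) : nat :=
  (\sum_(j < k) m j * w j)%N.

Definition wdeg (R : realType) (k : nat) (w : 'I_k -> nat)
    (f : {mpoly R[i][k]}) : nat :=
  (\max_(m <- msupp f) mnm_wdeg w m)%N.

Definition weighted_homogeneous (R : realType) (k : nat) (w : 'I_k -> nat)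
    (f : {mpoly R[i][k]}) : Prop :=
  forall m, m \in msupp f -> mnm_wdeg w m = wdeg w f.

(* The affine cone f = 0 in C^k is smooth away from the origin. *)
Definition quasi_smooth (R : realType) (k : nat) (f : {mpoly R[i][k]}) : Prop :=
  forall x : 'I_k -> R[i],
    (exists j, x j != 0) -> f.@[x] = 0 -> exists j, (f^`M(j)).@[x] != 0.

(* With m + 2 weights the ambient space has dimension m + 1, so a hypersurface
   (f = 0), with f homogeneous of positive degree, has dimension m. *)
Definition quasi_K3 (R : realType) (m : nat) (w : 'I_m.+2 -> nat)
    (f : {mpoly R[i][m.+2]}) : Prop :=
  [/\ well_formed w,
      weighted_homogeneous w f /\ (0 < wdeg w f)%N,
      quasi_smooth f,
      ~~ odd m
    & 2^-1 * m%:R * (wdeg w f)%:R = (sum_weights w)%:R :> rat].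

Definition fermat (R : realType) (k : nat) (n : 'I_k -> nat) : {mpoly R[i][k]} :=
  \sum_(j < k) 'X_j ^+ n j.

(* Partitions of 1 into unit fractions, listed by denominators. *)
Definition partitions4 : seq (seq nat) :=
  [:: [:: 2; 3; 7; 42]; [:: 2; 3; 8; 24]; [:: 2; 3; 9; 18]; [:: 2; 3; 10; 15];
      [:: 2; 3; 12; 12]; [:: 2; 4; 5; 20]; [:: 2; 4; 6; 12]; [:: 2; 4; 8; 8];
      [:: 2; 5; 5; 10]; [:: 2; 6; 6; 6]; [:: 3; 3; 4; 12]; [:: 3; 3; 6; 6];
      [:: 3; 4; 4; 6]; [:: 4; 4; 4; 4]]%N.

Definition partitions3 : seq (seq nat) :=
  [:: [:: 3; 3; 3]; [:: 2; 3; 6]; [:: 2; 4; 4]]%N.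

(* Main.v *)
Require Import Defs.
From mathcomp Require Import all_boot all_order all_algebra.
From mathcomp Require Import reals.
From mathcomp Require Import complex.
From mathcomp Require Import mpoly.
From mathcomp Require Import ring.

(** Every monomial [z_j ^ n_j] has the same weighted degree [d], so
    [w_j = d / n_j].  Substituting this in the quasi-K3 condition
    [m d / 2 = w_0 + ... + w_(m+1)] and dividing by [d] gives that the
    reciprocals of the exponents add up to [m / 2], which is [2] for a fourfold
    (lemma [quasi_K3_fermat_sum]).

    The rest is the classification of the ways to write [2] as a sum of six unit
    fractions with denominators at least 2.  Once the denominators are sorted,
    the first of [k] unit fractions with sum [p / q] is the largest, hence at
    least their average: its denominator [a] satisfies [a <= k q / p].  So there
    are finitely many choices for [a], and the others have sum
    [p / q - 1 / a = (p a - q) / (q a)].  The function [egyptian] performs this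
    search, [egyptian_complete] says that it misses nothing, and the theorem
    follows by comparing its output with the two lists. *)

Import Order.TTheory GRing.Theory Num.Theory.
Local Open Scope ring_scope.

(** The coefficients of a Fermat polynomial count its equal terms, so in
    characteristic 0 no term cancels. *)
Lemma fermat_msupp (R : realType) (k : nat) (n : 'I_k -> nat) (j : 'I_k) :
  (U_(j) *+ n j)%MM \in msupp (@fermat R k n).
Proof.
rewrite mcoeff_msupp /fermat raddf_sum /=.
under eq_bigr => i _ do rewrite mpolyXn mcoeffX.
rewrite -natr_sum pnatr_eq0 sum_nat_eq0 negb_forall.
by apply/existsP; exists j; rewrite eqxx.
Qed.

Lemma fermat_wdeg (R : realType) (k : nat) (w n : 'I_k -> nat)
    (homf : weighted_homogeneous w (@fermat R k n)) (j : 'I_k) :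
  (n j * w j)%N = wdeg w (@fermat R k n).
Proof.
rewrite -(homf _ (fermat_msupp R k n j)) /mnm_wdeg (bigD1 j) //=.
rewrite big1 => [|i i_neq_j]; rewrite mulmnE mnm1E.
  by rewrite eqxx mul1n addn0.
by rewrite eq_sym (negPf i_neq_j).
Qed.

Lemma quasi_K3_fermat_sum (R : realType) (m : nat) (w n : 'I_m.+2 -> nat)
    (n_gt0 : forall j, (0 < n j)%N) (hZ : quasi_K3 w (@fermat R _ n)) :
  \sum_(j < m.+2) (n j)%:R^-1 = 2^-1 * m%:R :> rat.
Proof.
case: hZ => _ [homf d_gt0] _ _; set d := wdeg w _ in d_gt0 * => sum_w.
have d_neq0 : d%:R != 0 :> rat by rewrite pnatr_eq0 -lt0n.
apply: (mulIf d_neq0); rewrite sum_w /sum_weights natr_sum mulr_suml.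
apply: eq_bigr => j _; rewrite /d -(fermat_wdeg R _ w n homf j) natrM.
by rewrite mulKf // pnatr_eq0 -lt0n.
Qed.

(** Enumerates the nondecreasing sequences of [k] denominators at least [lo]
    whose unit fractions add up to [p / q], which is not kept in lowest terms.
    The test [q <= p * a] says that [1 / a <= p / q]; it makes the truncated
    subtraction exact. *)
Fixpoint egyptian (k lo p q : nat) : seq (seq nat) :=
  if k is k'.+1 then
    flatten [seq [seq a :: s | s <- egyptian k' a (p * a - q) (q * a)]
            | a <- iota lo ((k * q %/ p).+1 - lo) & (q <= p * a)%N]
  else if p == 0%N then [:: [::]] else [::].

Lemma egyptian_complete (s : seq nat) (lo p q : nat) :
  (0 < lo)%N -> (0 < q)%N -> path leq lo s ->
  \sum_(a <- s) a%:R^-1 = p%:R / q%:R :> rat -> s \in egyptian (size s) lo p q.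
Proof.
elim: s lo p q => [|a s IHs] lo p q lo_gt0 q_gt0.
  rewrite big_nil => _ /eqP; rewrite eq_sym mulf_eq0 invr_eq0 !pnatr_eq0.
  by rewrite (gtn_eqF q_gt0) orbF /= => ->.
move=> /= /andP[lo_le_a a_path]; rewrite big_cons => sum_as.
have a_gt0 : (0 < a)%N := leq_trans lo_gt0 lo_le_a.
have aR_gt0 : 0 < a%:R :> rat by rewrite ltr0n.
have qR_gt0 : 0 < q%:R :> rat by rewrite ltr0n.
have a_le : all (leq a) s by apply: order_path_min a_path; apply: leq_trans.
have sum_s_ge0 : 0 <= \sum_(b <- s) b%:R^-1 :> rat.
  by apply: sumr_ge0 => b _; rewrite invr_ge0 ler0n.
have q_le_pa : (q <= p * a)%N.
  have : a%:R^-1 <= p%:R / q%:R :> rat by rewrite -sum_as lerDl.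
  by rewrite ler_pdivlMr // mulrC ler_pdivrMr // -natrM ler_nat.
have p_gt0 : (0 < p)%N.
  by rewrite lt0n; apply: contraTneq q_le_pa => ->; rewrite mul0n -ltnNge.
(* The first fraction is at least the average of all of them. *)
have pa_le : (p * a <= (size s).+1 * q)%N.
  have : p%:R / q%:R <= (size s).+1%:R / a%:R :> rat.
    rewrite -sum_as -natr1 mulrDl mul1r addrC lerD2r.
    rewrite mulr_natl -[size s]count_predT -iter_addr_0 -big_const_seq.
    rewrite big_seq [leRHS]big_seq.
    apply: ler_sum => b /(allP a_le) a_le_b.
    by rewrite lef_pV2 ?posrE ?ltr0n ?ler_nat // (leq_trans a_gt0).
  by rewrite ler_pdivrMr // mulrAC ler_pdivlMr // -!natrM ler_nat.
apply/flatten_mapP; exists a.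
  rewrite mem_filter q_le_pa mem_iota lo_le_a /= subnKC.
    by rewrite ltnS leq_divRL // mulnC.
  by rewrite leqW // (leq_trans lo_le_a) // leq_divRL // mulnC.
apply: map_f; apply: IHs => //; first by rewrite muln_gt0 q_gt0.
rewrite natrB // !natrM; apply: (addrI a%:R^-1); rewrite sum_as.
by field; rewrite !gt_eqF.
Qed.

Theorem theoremA10 (R : realType) (w n : 'I_6 -> nat)
    (hn : forall j : 'I_6, (1 < n j)%N)
    (hZ : @quasi_K3 R 4 w (@fermat R 6 n)) :
  2 = \sum_(j < 6) (n j)%:R^-1 :> rat /\
  ((exists2 a : seq nat, a \in partitions4 &
      perm_eq [seq n j | j : 'I_6] ([:: 2; 2]%N ++ a)) \/
   (exists alpha beta : seq nat,
      [/\ alpha \in partitions3, beta \in partitions3 &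
          perm_eq [seq n j | j : 'I_6] (alpha ++ beta)])).
Proof.
have sum_n : \sum_(j < 6) (n j)%:R^-1 = 2 :> rat.
  by rewrite (quasi_K3_fermat_sum R 4 w n (fun j => ltnW (hn j)) hZ).
split=> //; set l := [seq n j | j : 'I_6].
pose s := sort leq l.
have s_perm_l : perm_eq s l by rewrite perm_sort.
have s_path : path leq 2 s.
  rewrite path_min_sorted; first exact: sort_sorted leq_total l.
  by apply/allP => a; rewrite mem_sort => /codomP[j ->].
have s_in : s \in egyptian 6 2 2 1.
  have <- : size s = 6%N by rewrite size_sort size_map -cardE card_ord.
  apply: egyptian_complete => //.
  by rewrite (perm_big _ s_perm_l) big_map big_enum /= sum_n divr1.
have : all (fun t => has (fun a => perm_eq t ([:: 2; 2]%N ++ a)) partitions4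
    || has (fun alpha => has (fun beta => perm_eq t (alpha ++ beta))
         partitions3) partitions3) (egyptian 6 2 2 1) by vm_compute.
move=> /allP/(_ s s_in)/orP[/hasP[a a_in s_perm]|].
  by left; exists a; rewrite // -(permPl s_perm_l).
move=> /hasP[alpha alpha_in /hasP[beta beta_in s_perm]].
by right; exists alpha, beta; split; rewrite // -(permPl s_perm_l).
Qed.
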